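(* There exists an absolute constant $c>0$ such that for all positive integers $k,s$, all $\lambda>0$, and every symmetric gauge function $\tau$ on $\mathbb{R}^{k\wedge s}$ with associated unitarily invariant norm $\|\cdot\|_\tau$ on $\mathbb{R}^{k\times s}$, the following holds. Suppose one observes a $k\times s$ random matrix $X=(X_{ij})$ with independent entries $X_{ij}\sim\mathrm{Poisson}(\lambda_{ij})$, where $\Lambda=(\lambda_{ij})\in\Gamma(k,s,\lambda)$ is unknown. Then $$\inf_{\widehat\Lambda}\ \sup_{\Lambda\in\Gamma(k,s,\lambda)}\mathbb{E}\|\widehat\Lambda-\Lambda\|_\tau^2\ \ge\ c\,(k\vee s)\,\tau^2(\mathbf 1)\,(\lambda\wedge\lambda^2),$$ where the infimum is over all estimators $\widehat\Lambda=\widehat\Lambda(X)$ and $\mathbf 1$ is the all-one vector in $\mathbb{R}^{k\wedge s}$.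
   Context: $a\vee b=\max\{a,b\}$, $a\wedge b=\min\{a,b\}$. $\Gamma(k,s,\lambda)=\{\Lambda=(\lambda_{ij})\in\mathbb{R}_+^{k\times s}:\lambda_{ij}\le\lambda \text{ for all } i,j\}$. A symmetric gauge function on $\mathbb{R}^d$ is a norm on $\mathbb{R}^d$ invariant under permutations and sign changes of coordinates, and $\|A\|_\tau=\tau(\sigma(A))$, where $\sigma(A)\in\mathbb{R}^{k\wedge s}$ is the vector of ordered singular values of $A\in\mathbb{R}^{k\times s}$; every unitarily invariant norm on $\mathbb{R}^{k\times s}$ is of this form. An estimator is a measurable function of the observation. *)

(* Defs.v *)
(* MathComp / MathComp-Analysis *)
From HB Require Import structures.
From mathcomp Require Import all_boot all_order perm all_algebra.
From mathcomp Require Import all_classical all_reals all_analysis.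

Set Implicit Arguments.
Unset Strict Implicit.
Unset Printing Implicit Defensive.

Import Order.TTheory GRing.Theory Num.Theory.

Local Open Scope classical_set_scope.
Local Open Scope ring_scope.

Record symmetric_gauge (R : realType) (d : nat) (tau : 'rV[R]_d -> R) : Prop :=
  SymmetricGauge {
    gauge_ge0 : forall x : 'rV[R]_d, 0 <= tau x;
    gauge_eq0 : forall x : 'rV[R]_d, tau x = 0 -> x = 0;
    gauge_homo : forall (a : R) (x : 'rV[R]_d), tau (a *: x) = `|a| * tau x;
    gauge_triangle : forall x y : 'rV[R]_d, tau (x + y) <= tau x + tau y;
    gauge_perm : forall (p : 'S_d) (x : 'rV[R]_d), tau (col_perm p x) = tau x;
    gauge_sign : forall (e : 'I_d -> bool) (x : 'rV[R]_d),
      tau (\row_i ((-1) ^+ e i * x 0 i)) = tau x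
  }.

(* Thin singular value decomposition A = U diag(sigma) V^T, where U and V have
   minn k s orthonormal columns; it determines sigma uniquely. *)
Definition is_singular_values (R : realType) (k s : nat)
    (A : 'M[R]_(k, s)) (sigma : 'rV[R]_(minn k s)) : Prop :=
  [/\ forall i, 0 <= sigma 0 i,
      forall i j : 'I_(minn k s), (i <= j)%N -> sigma 0 j <= sigma 0 i &
      exists (U : 'M[R]_(k, minn k s)) (V : 'M[R]_(s, minn k s)),
        [/\ U^T *m U = 1%:M, V^T *m V = 1%:M & A = U *m diag_mx sigma *m V^T]].

(* Every real matrix has a singular value decomposition, so the default value 0
   is never used. *)
Definition singular_values (R : realType) (k s : nat) (A : 'M[R]_(k, s)) :
    'rV[R]_(minn k s) :=
  xget 0 [set sigma | is_singular_values A sigma].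

Definition unitarily_invariant_norm (R : realType) (k s : nat)
    (tau : 'rV[R]_(minn k s) -> R) (A : 'M[R]_(k, s)) : R :=
  tau (singular_values A).

Definition Gamma (R : realType) (k s : nat) (lambda : R) : set 'M[R]_(k, s) :=
  [set L | forall i j, 0 <= L i j <= lambda].
Arguments Gamma {R} k s lambda.

Definition mutually_independent (R : realType) (d : measure_display)
    (T : measurableType d) (P : probability T R) (I : finType)
    (d' : measure_display) (T' : measurableType d') (Y : I -> T -> T') : Prop :=
  forall (J : {set I}) (B : I -> set T'), (forall i, measurable (B i)) ->
    P (\bigcap_(i in [set` J]) Y i @^-1` B i) =
    (\prod_(i in J) P (Y i @^-1` B i))%E.

(* poisson_prob r m does not depend on its second argument m; at rate r = 0 it
   is the Dirac mass at 0. *)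
Definition independent_poisson (R : realType) (d : measure_display)
    (T : measurableType d) (P : probability T R) (k s : nat)
    (X : 'I_k -> 'I_s -> {mfun T >-> nat}) (L : 'M[R]_(k, s)) : Prop :=
  (forall i j (B : set nat), measurable B ->
     distribution P (X i j) B = poisson_prob (L i j) 0 B) /\
  mutually_independent P (fun ij : 'I_k * 'I_s => X ij.1 ij.2 : T -> nat).

Definition observation (T : Type) (k s : nat) (X : 'I_k -> 'I_s -> T -> nat)
    (w : T) : 'M[nat]_(k, s) :=
  \matrix_(i, j) X i j w.

(* The observation space 'M[nat]_(k, s) is countable and carries the discrete
   sigma-algebra, so that every function on it is measurable: estimators are
   arbitrary functions of the observation.  P L is the law of the experiment
   when the unknown matrix is L. *)
Definition minimax_risk (R : realType) (d : measure_display)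
    (T : measurableType d) (k s : nat) (P : 'M[R]_(k, s) -> probability T R)
    (X : 'I_k -> 'I_s -> T -> nat) (N : 'M[R]_(k, s) -> R)
    (G : set 'M[R]_(k, s)) : \bar R :=
  ereal_inf (range (fun est : 'M[nat]_(k, s) -> 'M[R]_(k, s) =>
    ereal_sup
      [set ('E_(P L)[fun w => (N (est (observation X w) - L) ^+ 2)%R])%E
      | L in G])).

(* Main.v *)
Require Import Defs.
From mathcomp Require Import all_boot all_order perm all_algebra.
From mathcomp Require Import all_classical all_reals all_analysis.
From mathcomp Require Import measurable_realfun.
From mathcomp Require Import ring lra.

Set Implicit Arguments.
Unset Strict Implicit.
Unset Printing Implicit Defensive.

Import Order.TTheory GRing.Theory Num.Theory.
Import numFieldNormedType.Exports.

Local Open Scope classical_set_scope.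
Local Open Scope ring_scope.

(** The lower bound comes from a random parameter with independent two-valued
    entries. Put D = (lambda /\ sqrt lambda) / 4 and let every rate be
    lambda - D or lambda. The two Poisson laws of an entry then overlap in mass
    at least 1/2, because their chi-square divergence is small
    [poisson_overlap], and D^2 = (lambda /\ lambda^2) / 16.

    Writing each of the two mass functions as its common part q, the pointwise
    minimum, plus a rest, and expanding the product over the entries, exhibits
    the law of the observation as a mixture over sets S of entries: on S the
    observation carries no information on the parameter, off S it may reveal it
    [mixture_lower_bound]. Given S and the observation, the parameter and the
    one obtained by switching all entries of S are equally likely, so by the
    triangle inequality the estimator loses on average at least half the norm
    of their difference, which is D times a matrix with random signs on S and
    zeros elsewhere.

    Such a matrix is large in every unitarily invariant norm. Averaging a
    symmetric gauge over all permutations of the coordinates bounds it below by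
    the nuclear norm divided by k /\ s, times tau(1) [gauge_ge_mean]. The
    nuclear norm in turn is bounded below by second and fourth moments of the
    singular values, that is by traces, whose averages over the signs are
    explicit: it is at least |S| / (2 sqrt (k \/ s)) on average
    [sum_sign_mx_nuclear_norm]. Since |S| is on average at least a fixed
    fraction of k s = (k /\ s) (k \/ s), the mean loss is at least a constant
    times D tau(1) sqrt (k \/ s), and the mean squared loss at least its square.

    Only finitely many observations are needed: a lower bound on the risk may
    ignore those with an entry K or larger [expectation_ge_partial_sum], where
    K is chosen in terms of k s so that they have small probability.

    Singular values are accessible only once the singular value decomposition
    is known to exist [thin_svd_exists]. It gives the duality between the
    nuclear norm and matrices with orthonormal columns, and from it the triangle
    inequality on which the comparison of two parameters rests. *)

(** * Euclidean norms of column vectors *)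

Lemma sqnormE (R : realType) n (x : 'cV[R]_n) :
  (x^T *m x) 0 0 = \sum_i x i 0 ^+ 2.
Proof. by rewrite mxE; apply: eq_bigr => i _; rewrite mxE expr2. Qed.

Lemma sqnorm_ge0 (R : realType) n (x : 'cV[R]_n) : 0 <= (x^T *m x) 0 0.
Proof. by rewrite sqnormE sumr_ge0// => i _; rewrite sqr_ge0. Qed.

Lemma sqnorm_eq0 (R : realType) n (x : 'cV[R]_n) : (x^T *m x) 0 0 = 0 -> x = 0.
Proof.
rewrite sqnormE => /eqP.
rewrite psumr_eq0 => [/allP x0|i _]; last exact: sqr_ge0.
apply/matrixP => i j; rewrite (ord1 j) mxE; apply/eqP; rewrite -sqrf_eq0.
by apply: x0; rewrite mem_index_enum.
Qed.

Lemma sqnormZ (R : realType) n (a : R) (x : 'cV[R]_n) :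
  ((a *: x)^T *m (a *: x)) 0 0 = a ^+ 2 * (x^T *m x) 0 0.
Proof.
by rewrite !sqnormE mulr_sumr; apply: eq_bigr => i _; rewrite mxE exprMn.
Qed.

Lemma gram_isometry (R : realType) m n p (H : 'M[R]_(m, n)) (x : 'M[R]_(n, p)) :
  H^T *m H = 1%:M -> (H *m x)^T *m (H *m x) = x^T *m x.
Proof. by move=> H1; rewrite trmx_mul -mulmxA (mulmxA H^T) H1 mul1mx. Qed.

(** The difference of the two sides is the squared norm of x - W W^T x. *)
Lemma bessel (R : realType) k m (W : 'M[R]_(k, m)) (x : 'cV[R]_k) :
  W^T *m W = 1%:M ->
  ((W^T *m x)^T *m (W^T *m x)) 0 0 <= (x^T *m x) 0 0.
Proof.
move=> W1; have := sqnorm_ge0 (x - W *m (W^T *m x)).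
set y := W^T *m x.
have -> : (x - W *m y)^T = x^T - y^T *m W^T.
  by rewrite linearB /= trmx_mul.
rewrite mulmxBl !mulmxBr -!(mulmxA y^T) (mulmxA W^T W) W1 mul1mx -/y.
have -> : x^T *m (W *m y) = y^T *m y by rewrite mulmxA {2}/y trmx_mul trmxK.
by rewrite subrr subr0 [X in 0 <= X -> _]mxE [X in 0 <= _ + X -> _]mxE subr_ge0.
Qed.

Lemma orthonormal_col (R : realType) k m (U : 'M[R]_(k, m)) i :
  U^T *m U = 1%:M -> ((col i U)^T *m col i U) 0 0 = 1.
Proof.
move=> /matrixP/(_ i i); rewrite [RHS]mxE eqxx mulr1n => <-.
by rewrite !mxE; apply: eq_bigr => j _; rewrite !mxE.
Qed.

(** * Singular value decomposition *)

Lemma quadratic_form_continuous (R : realType) n (B : 'M[R]_n) :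
  continuous (fun v : 'rV[R]_n => (v *m B *m v^T) 0 0).
Proof.
have -> : (fun v : 'rV[R]_n => (v *m B *m v^T) 0 0) =
    (fun v => \sum_j \sum_i v 0 i * B i j * v 0 j).
  apply/funext => v; rewrite mxE; apply: eq_bigr => j _.
  by rewrite mxE [v^T _ _]mxE mulr_suml.
have cadd : continuous (fun x : R^o * R^o => x.1 + x.2).
  exact: add_continuous.
apply: (continuous_big cadd) => j _; apply: (continuous_big cadd) => i _ v.
apply: (@continuousM _ _ (fun v : 'rV[R]_n => v 0 i * B i j) (fun v => v 0 j)).
  apply: (@continuousM _ _ (fun v : 'rV[R]_n => v 0 i) (cst (B i j))).
    exact: coord_continuous.
  exact: cst_continuous.
exact: coord_continuous.
Qed.

(** Compactness of the unit sphere provides the maximiser; vectors of other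
    lengths follow by homogeneity. *)
Lemma max_stretch (R : realType) k n (A : 'M[R]_(k, n.+1)) :
  exists v : 'cV[R]_n.+1, (v^T *m v) 0 0 = 1 /\
    forall x : 'cV[R]_n.+1,
      ((A *m x)^T *m (A *m x)) 0 0 <=
      ((A *m v)^T *m (A *m v)) 0 0 * (x^T *m x) 0 0.
Proof.
pose S := [set v : 'rV[R]_n.+1 | (v *m 1%:M *m v^T) 0 0 = 1].
pose f (v : 'rV[R]_n.+1) := (v *m (A^T *m A) *m v^T) 0 0.
have fE v : f v^T = ((A *m v)^T *m (A *m v)) 0 0.
  by rewrite /f trmxK trmx_mul !mulmxA.
have S0 : S !=set0.
  exists (delta_mx 0 0); rewrite /S /= mulmx1 trmx_delta mul_delta_mx.
  by rewrite !mxE eqxx.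
have clS : closed S.
  rewrite [S](_ : _ =
    (fun v : 'rV[R]_n.+1 => (v *m 1%:M *m v^T) 0 0) @^-1` [set 1]) //.
  apply: closed_comp; last exact: closed_eq.
  by move=> x _; exact: quadratic_form_continuous.
have bS : bounded_set S.
  exists 1; split; first exact: num_real.
  move=> M M1 v Sv; rewrite /Num.norm /= mx_normrE.
  apply/bigmax_leP; split; first exact: le_trans ler01 (ltW M1).
  move=> [i j] _ /=; rewrite (ord1 i); apply: le_trans (ltW M1).
  rewrite -(@ler_pXn2r _ 2)// ?nnegrE// expr1n real_normK ?num_real//.
  rewrite /S /= mulmx1 -{1}[v]trmxK sqnormE in Sv; rewrite -Sv.
  rewrite (bigD1 j)//= mxE lerDl sumr_ge0// => l _; exact: sqr_ge0.
have [c cS cmax] := compact_EVT_max S0 (bounded_closed_compact bS clS)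
  (continuous_subspaceT (@quadratic_form_continuous R _ (A^T *m A))).
have cc : (c *m c^T) 0 0 = 1 by move: cS; rewrite inE /S /= mulmx1.
exists c^T; rewrite trmxK; split=> // x.
have [x0|x_neq0] := eqVneq ((x^T *m x) 0 0) 0.
  by rewrite (sqnorm_eq0 x0) !mulmx0 !mxE mulr0.
have x_gt0 : 0 < (x^T *m x) 0 0 by rewrite lt_neqAle eq_sym x_neq0 sqnorm_ge0.
set r := (x^T *m x) 0 0 in x_neq0 x_gt0 *.
pose y := (Num.sqrt r)^-1 *: x.
have r2 : (Num.sqrt r)^-1 ^+ 2 = r^-1.
  by rewrite exprVn sqr_sqrtr// ltW.
have yS : y^T \in S.
  by rewrite inE /S /= mulmx1 trmxK sqnormZ r2 mulVf.
have := cmax _ yS; rewrite -/(f y^T) -/(f c) fE -(trmxK c) fE trmxK.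
rewrite /y -scalemxAr sqnormZ r2 mulrC.
by rewrite -ler_pdivlMr ?invr_gt0// invrK.
Qed.

(** Along the line v + t B v the form equals 2 t |B v|^2 + O(t^2), which would
    be negative for some small t < 0 if B v were not zero. *)
Lemma psd_kernel (R : realType) n (B : 'M[R]_n) (v : 'cV[R]_n) :
  B^T = B -> (forall x : 'cV[R]_n, 0 <= (x^T *m B *m x) 0 0) ->
  (v^T *m B *m v) 0 0 = 0 -> B *m v = 0.
Proof.
move=> symB psd v0; apply: sqnorm_eq0.
pose w := B *m v; pose c := (w^T *m B *m w) 0 0; pose b := (w^T *m w) 0 0.
have c0 : 0 <= c by exact: psd.
(* The quadratic 2 t b + t^2 c has its minimum at - b / c; the shift to c + 1
   keeps the denominator positive when c = 0. *)
pose t := - b / (c + 1).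
have := psd (v + t *: w).
have -> : ((v + t *: w)^T *m B *m (v + t *: w)) 0 0 = 2 * t * b + t ^+ 2 * c.
  have -> : (v + t *: w)^T = v^T + t *: w^T.
    by apply/matrixP => i j; rewrite !mxE.
  rewrite !mulmxDl !mulmxDr -!scalemxAl -!scalemxAr.
  have eD (X Y : 'M[R]_1) : (X + Y) 0 0 = X 0 0 + Y 0 0 by rewrite mxE.
  have eZ (a : R) (X : 'M[R]_1) : (a *: X) 0 0 = a * X 0 0 by rewrite mxE.
  rewrite !(eD, eZ) v0 -/c.
  have -> : (w^T *m B *m v) 0 0 = b by rewrite -mulmxA.
  have -> : (v^T *m B *m w) 0 0 = b by rewrite /b {2}/w trmx_mul symB.
  ring.
have c1 : c + 1 != 0 by rewrite gt_eqF// ltr_wpDl.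
have -> : 2 * t * b + t ^+ 2 * c = - (b ^+ 2 * (c + 2) / (c + 1) ^+ 2).
  by rewrite /t; field.
rewrite oppr_ge0 pmulr_lle0 ?invr_gt0 ?exprn_gt0 ?ltr_wpDl//.
rewrite pmulr_lle0 ?ltr_wpDl// => b2; apply/eqP; rewrite -sqrf_eq0.
by rewrite eq_le b2 sqr_ge0.
Qed.

(** At a maximiser v of |A x| on the unit sphere, the matrix |A v|^2 - A^T A is
    positive semidefinite and its form vanishes at v, so v is an eigenvector of
    A^T A. An arbitrary eigenvector would not do: its eigenvalue may be 0 while
    A^T u = 0 has no solution u <> 0. The maximal one is 0 only for A = 0. *)
Lemma top_singular_triple (R : realType) k n (A : 'M[R]_(k.+1, n.+1)) :
  exists (c : R) (u : 'cV[R]_k.+1) (v : 'cV[R]_n.+1),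
    [/\ 0 <= c, u^T *m u = 1%:M, v^T *m v = 1%:M,
        A *m v = c *: u & A^T *m u = c *: v] /\
    forall x : 'cV[R]_n.+1,
      ((A *m x)^T *m (A *m x)) 0 0 <= c ^+ 2 * (x^T *m x) 0 0.
Proof.
have [v [v1 vmax]] := max_stretch A.
have unitE m (x : 'cV[R]_m) : (x^T *m x) 0 0 = 1 -> x^T *m x = 1%:M.
  by move=> x1; rewrite [LHS]mx11_scalar x1.
set mu := ((A *m v)^T *m (A *m v)) 0 0 in vmax.
have mu0 : 0 <= mu by exact: sqnorm_ge0.
have [mu_eq0|mu_neq0] := eqVneq mu 0.
  have A0 : A = 0.
    apply/matrixP => i j; have := vmax (delta_mx j 0).
    rewrite mu_eq0 mul0r => Aj.
    have : A *m delta_mx j 0 = 0 :> 'cV[R]_k.+1.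
      by apply: sqnorm_eq0; apply/eqP; rewrite eq_le Aj sqnorm_ge0.
    by rewrite -colE => /matrixP/(_ i 0); rewrite !mxE.
  exists 0, (delta_mx 0 0), v; split.
    split; rewrite ?A0 ?scale0r ?trmx0 ?mul0mx//; apply: unitE => //.
    by rewrite trmx_delta mul_delta_mx mxE.
  by move=> x; rewrite A0 mul0mx trmx0 mul0mx mxE expr0n mul0r.
have mu_gt0 : 0 < mu by rewrite lt_neqAle eq_sym mu_neq0.
pose c := Num.sqrt mu.
have c2 : c ^+ 2 = mu by rewrite sqr_sqrtr.
have c_neq0 : c != 0 by rewrite gt_eqF ?sqrtr_gt0.
pose B := mu%:M - A^T *m A.
have BE (x : 'cV_n.+1) : (x^T *m B *m x) 0 0 =
    mu * (x^T *m x) 0 0 - ((A *m x)^T *m (A *m x)) 0 0.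
  rewrite /B mulmxBr mulmxBl mul_mx_scalar -scalemxAl trmx_mul !mulmxA.
  by rewrite [LHS]mxE [X in X + _]mxE [X in _ + X]mxE.
have Bv : B *m v = 0.
  apply: psd_kernel.
  - by rewrite /B linearB /= tr_scalar_mx trmx_mul trmxK.
  - by move=> x; rewrite BE subr_ge0.
  - by rewrite BE v1 mulr1 subrr.
have AAv : A^T *m (A *m v) = mu *: v.
  move: Bv; rewrite /B mulmxBl mul_scalar_mx mulmxA => /eqP.
  by rewrite subr_eq0 => /eqP.
exists c, (c^-1 *: (A *m v)), v; split; last by move=> x; rewrite c2.
split.
- exact: sqrtr_ge0.
- by apply: unitE; rewrite sqnormZ exprVn c2 mulVf.
- exact: unitE.
- by rewrite scalerA mulfV// scale1r.
- by rewrite -scalemxAr AAv scalerA -c2 expr2 mulKf.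
Qed.

(** The reflection in the hyperplane orthogonal to u - e maps the first basis
    vector e to u; its matrix involves 2 / |u - e|^2 = 1 / (1 - u_0). *)
Lemma reflection_to_unit_vector (R : realType) n (u : 'cV[R]_(1 + n)) :
  u^T *m u = 1%:M ->
  exists H : 'M[R]_(1 + n), H^T *m H = 1%:M /\ H *m delta_mx 0 0 = u.
Proof.
move=> u1.
pose e : 'cV[R]_(1 + n) := delta_mx 0 0.
have [->|u_neq_e] := eqVneq u e.
  by exists 1%:M; rewrite trmx1 !mul1mx.
pose w := u - e; pose c := (1 - u 0 0)^-1.
have ee : e^T *m e = 1%:M.
  by rewrite trmx_delta mul_delta_mx [LHS]mx11_scalar mxE.
have eu : e^T *m u = (u 0 0)%:M.
  by rewrite trmx_delta -rowE [LHS]mx11_scalar mxE.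
have ue : u^T *m e = (u 0 0)%:M.
  by rewrite -[LHS]trmxK trmx_mul trmxK eu tr_scalar_mx.
have trw : w^T = u^T - e^T by rewrite linearB.
have ww : w^T *m w = (2 * (1 - u 0 0))%:M.
  rewrite trw mulmxBl !mulmxBr u1 ue eu ee -!raddfB /=.
  by congr (_%:M); ring.
have we : w^T *m e = (u 0 0 - 1)%:M.
  by rewrite trw mulmxBl ue ee -raddfB.
have u00 : 1 - u 0 0 != 0.
  apply: contra_neq u_neq_e => u00; apply/eqP; rewrite -subr_eq0; apply/eqP.
  by apply: sqnorm_eq0; rewrite -/w ww u00 mulr0 mxE.
pose H : 'M[R]_(1 + n) := 1%:M - c *: (w *m w^T).
have trH : H^T = H.
  by rewrite /H linearB linearZ /= trmx1 trmx_mul trmxK.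
exists H; split.
  have WW : w *m w^T *m (w *m w^T) = (2 * (1 - u 0 0)) *: (w *m w^T).
    by rewrite -mulmxA (mulmxA w^T) ww mul_scalar_mx -scalemxAr.
  rewrite trH /H; move: (w *m w^T) WW => W WW.
  rewrite mulmxBl mul1mx mulmxBr mulmx1 -scalemxAl -scalemxAr WW.
  by apply/matrixP => i j; rewrite !mxE /c; field.
rewrite /H mulmxBl mul1mx -scalemxAl -mulmxA -/e we mul_mx_scalar scalerA.
have -> : c * (u 0 0 - 1) = -1 by rewrite /c; field.
by rewrite scaleN1r opprK /w addrC subrK.
Qed.

(** Deflation: reflections sending the first basis vectors to a top singular
    pair turn A into a block diagonal matrix with the top singular value c in
    the corner, and the induction hypothesis applies to the other block. The
    singular values come out sorted because c bounds the operator norm of A. The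
    number m of columns is a parameter tied to minn k s by an equation, so that
    the induction can peel off one row and one column. *)
Lemma thin_svd_exists (R : realType) m k s (A : 'M[R]_(k, s)) :
  m = minn k s ->
  exists (sigma : 'rV[R]_m) (U : 'M[R]_(k, m)) (V : 'M[R]_(s, m)),
  [/\ forall i, 0 <= sigma 0 i,
      forall i j : 'I_m, (i <= j)%N -> sigma 0 j <= sigma 0 i,
      U^T *m U = 1%:M, V^T *m V = 1%:M & A = U *m diag_mx sigma *m V^T].
Proof.
elim: m k s A => [|m IH] k s A.
  move=> mE; exists 0, 0, 0; split; try by case.
  - by apply/matrixP; case.
  - by apply/matrixP; case.
  - rewrite mul0mx; apply/matrixP => i j; exfalso.
    have : (0 < minn k s)%N.
      rewrite leq_min (leq_ltn_trans _ (ltn_ord i))//.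
      by rewrite (leq_ltn_trans _ (ltn_ord j)).
    by rewrite -mE.
case: k A => [|k] A; first by rewrite min0n.
case: s A => [|s] A; first by rewrite minn0.
rewrite minnSS => -[mE].
have [c [u [v [[c0 u1 v1 Av Au] cmax]]]] := top_singular_triple A.
have [Hu [Hu1 Hue]] := reflection_to_unit_vector u1.
have [Hv [Hv1 Hve]] := reflection_to_unit_vector v1.
pose B : 'M[R]_(1 + k, 1 + s) := Hu^T *m A *m Hv.
have Be : B *m delta_mx 0 0 = c *: (delta_mx 0 0 : 'cV[R]_(1 + k)).
  by rewrite /B -mulmxA Hve -mulmxA Av -scalemxAr -Hue mulmxA Hu1 mul1mx.
have eB : (delta_mx 0 0 : 'cV[R]_(1 + k))^T *m B =
    c *: (delta_mx 0 0 : 'cV[R]_(1 + s))^T.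
  rewrite /B !mulmxA -trmx_mul Hue.
  have -> : u^T *m A = c *: v^T.
    by rewrite -[LHS]trmxK trmx_mul trmxK Au linearZ.
  by rewrite -scalemxAl -Hve trmx_mul -mulmxA Hv1 mulmx1.
have AE : A = Hu *m B *m Hv^T.
  rewrite /B !mulmxA mulmx1C// mul1mx.
  by rewrite -mulmxA mulmx1C// mulmx1.
have AHv (x : 'cV[R]_(1 + s)) : A *m (Hv *m x) = Hu *m (B *m x).
  by rewrite AE -!mulmxA (mulmxA Hv^T) Hv1 mul1mx.
clearbody B.
have Bblock : B = block_mx c%:M 0 0 (drsubmx B).
  rewrite -[LHS]submxK; congr block_mx.
  - move: Be => /matrixP/(_ 0 0); rewrite -colE !mxE eqxx mulr1 => B00.
    apply/matrixP => i j; rewrite !ord1 !mxE eqxx mulr1n -B00.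
    by apply: (f_equal2 B); exact/val_inj.
  - apply/matrixP => i j; rewrite !mxE (ord1 i).
    move: eB => /matrixP/(_ 0 (rshift 1 j)).
    rewrite trmx_delta -rowE trmx_delta !mxE /= mulr0 => <-.
    by apply: (f_equal2 B); exact/val_inj.
  - apply/matrixP => i j; rewrite !mxE (ord1 j).
    move: Be => /matrixP/(_ (rshift 1 i) 0).
    rewrite -colE !mxE /= mulr0 => <-.
    by apply: (f_equal2 B); exact/val_inj.
have [sg [U [V [sg0 sgle U1 V1 A'E]]]] := IH _ _ (drsubmx B) mE.
have sg_le_c i : sg 0 i <= c.
  pose e : 'cV[R]_m := delta_mx i 0.
  have sqn p (W : 'M[R]_(p, m)) (H : 'M[R]_(1 + p)) :
      H^T *m H = 1%:M -> W^T *m W = 1%:M ->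
      ((H *m col_mx 0 (W *m e))^T *m
       (H *m col_mx 0 (W *m e))) 0 0 = 1.
    move=> H1 W1; rewrite gram_isometry// tr_col_mx mul_row_col mulmx0 add0r.
    by rewrite gram_isometry// /e trmx_delta mul_delta_mx mxE eqxx.
  have := cmax (Hv *m col_mx 0 (V *m e)).
  rewrite sqn//.
  have -> : A *m (Hv *m col_mx 0 (V *m e)) =
      sg 0 i *: (Hu *m col_mx 0 (U *m e)).
    rewrite AHv Bblock mul_block_col !mulmx0 !mul0mx !add0r A'E.
    rewrite -(mulmxA (U *m _)) (mulmxA V^T) V1 mul1mx.
    rewrite -(mulmxA U).
    have -> : diag_mx sg *m e = sg 0 i *: e.
      apply/matrixP => a b; rewrite mul_diag_mx !mxE.
      by case: eqP => [->|_]//=; rewrite !mulr0.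
    by rewrite -scalemxAr [RHS]scalemxAr scale_col_mx scaler0.
  rewrite sqnormZ sqn// !mulr1.
  by rewrite ler_pXn2r// nnegrE.
pose U' : 'M[R]_(1 + k, 1 + m) := Hu *m block_mx 1%:M 0 0 U.
pose V' : 'M[R]_(1 + s, 1 + m) := Hv *m block_mx 1%:M 0 0 V.
have orth p (H : 'M[R]_(1 + p)) (W : 'M[R]_(p, m)) : H^T *m H = 1%:M ->
    W^T *m W = 1%:M -> (H *m block_mx 1%:M 0 0 W)^T *m
      (H *m block_mx 1%:M 0 0 W) = 1%:M :> 'M[R]_(1 + m).
  move=> H1 W1; rewrite gram_isometry//.
  rewrite tr_block_mx mulmx_block !trmx0 trmx1 !mulmx0 !mul0mx mul1mx W1.
  by rewrite !addr0 !add0r -scalar_mx_block.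
pose sg' : 'rV[R]_(1 + m) := row_mx c%:M sg.
have sg'0 : sg' 0 (lshift m (0 : 'I_1)) = c by rewrite row_mxEl mxE.
have sg'S i : sg' 0 (rshift 1 i) = sg 0 i by rewrite row_mxEr.
exists sg', U', V'; split.
- by move=> i; case: (@split_ordP 1 m i) => j ->; rewrite ?(ord1 j) ?sg'0 ?sg'S.
- move=> i j; case: (@split_ordP 1 m i) => i' ->;
    case: (@split_ordP 1 m j) => j' ->;
    rewrite ?(ord1 i') ?(ord1 j') ?sg'0 ?sg'S//=.
  by move=> ij; exact: sgle.
- exact: orth.
- exact: orth.
- have core : B = block_mx 1%:M 0 0 U *m diag_mx sg' *m (block_mx 1%:M 0 0 V)^T.
    have -> : diag_mx sg' = block_mx c%:M 0 0 (diag_mx sg).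
      rewrite /sg' diag_mx_row; congr block_mx; apply/matrixP => a b.
      by rewrite !mxE !ord1.
    rewrite Bblock A'E tr_block_mx !trmx0 trmx1 !mulmx_block.
    by rewrite !(mulmx0, mul0mx, mulmx1, mul1mx, addr0, add0r).
  by rewrite AE core /U' /V' trmx_mul !mulmxA.
Qed.

Lemma singular_values_spec (R : realType) k s (A : 'M[R]_(k, s)) :
  is_singular_values A (singular_values A).
Proof.
rewrite /singular_values.
apply: (@xgetPex _ 0 [set sg | is_singular_values A sg]).
have [sg [U [V [sg0 sgle U1 V1 AE]]]] := thin_svd_exists A erefl.
by exists sg; split=> //; exists U, V.
Qed.

(** * Nuclear norm and symmetric gauges *)

Definition nuclear_norm (R : realType) k s (A : 'M[R]_(k, s)) : R :=
  \sum_i singular_values A 0 i.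

Lemma nuclear_norm_ge0 (R : realType) k s (A : 'M[R]_(k, s)) :
  0 <= nuclear_norm A.
Proof. by have [sg0 _ _] := singular_values_spec A; exact: sumr_ge0. Qed.

(** The trace is the sum of the singular values of A weighted by inner products
    of Q^T v_i and P^T u_i, vectors of norm at most 1 by Bessel's inequality.
    Equality holds when P and Q consist of singular vectors of A. *)
Lemma trace_le_nuclear_norm (R : realType) k s m (A : 'M[R]_(k, s))
    (P : 'M[R]_(k, m)) (Q : 'M[R]_(s, m)) :
  P^T *m P = 1%:M -> Q^T *m Q = 1%:M ->
  \tr (P^T *m A *m Q) <= nuclear_norm A.
Proof.
move=> P1 Q1; have [sg0 _ [U [V [U1 V1 AE]]]] := singular_values_spec A.
rewrite /nuclear_norm; set sg := singular_values A in sg0 AE *.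
have -> : \tr (P^T *m A *m Q) = \tr (diag_mx sg *m (V^T *m Q *m (P^T *m U))).
  by rewrite AE !mulmxA mxtrace_mulC !mulmxA mxtrace_mulC !mulmxA
    mxtrace_mulC !mulmxA.
rewrite /mxtrace; apply: ler_sum => i _; rewrite mul_diag_mx mxE.
rewrite -[leRHS]mulr1; apply: ler_wpM2l => //; rewrite mxE.
have bound n (W : 'M[R]_(n, m)) (Y : 'M[R]_(n, minn k s)) :
    W^T *m W = 1%:M -> Y^T *m Y = 1%:M -> \sum_j (W^T *m Y) j i ^+ 2 <= 1.
  move=> W1 Y1; rewrite -(orthonormal_col i Y1); apply: le_trans (bessel _ W1).
  rewrite sqnormE; apply: ler_sum => j _; rewrite !mxE.
  by under [in leRHS]eq_bigr do rewrite [col _ _ _ _]mxE.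
apply: (@le_trans _ _ (2^-1 * \sum_j (Q^T *m V) j i ^+ 2 +
                       2^-1 * \sum_j (P^T *m U) j i ^+ 2)); last first.
  have := bound _ _ _ Q1 V1; have := bound _ _ _ P1 U1; lra.
rewrite !mulr_sumr -big_split /=; apply: ler_sum => j _.
have -> : (V^T *m Q) i j = (Q^T *m V) j i.
  by rewrite -[V^T *m Q]trmxK trmx_mul trmxK mxE.
set a := (Q^T *m V) j i; set b := (P^T *m U) j i.
have := sqr_ge0 (a - b); rewrite sqrrB; lra.
Qed.

(** The nuclear norm of A - B is its trace against its own singular vectors;
    this test splits linearly into a test of A and one of - B. *)
Lemma nuclear_norm_sub (R : realType) k s (A B : 'M[R]_(k, s)) :
  nuclear_norm (A - B) <= nuclear_norm A + nuclear_norm B.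
Proof.
have [sg0 _ [U [V [U1 V1 AE]]]] := singular_values_spec (A - B).
rewrite {1}/nuclear_norm; set sg := singular_values (A - B) in sg0 AE *.
have -> : \sum_i sg 0 i = \tr (U^T *m A *m V) + \tr ((- U)^T *m B *m V).
  have -> : (- U)^T = - U^T by apply/matrixP => i j; rewrite !mxE.
  rewrite !mulNmx -raddfD /= -mulmxBl -mulmxBr AE.
  by rewrite !mulmxA U1 mul1mx -mulmxA V1 mulmx1 mxtrace_diag.
rewrite lerD// trace_le_nuclear_norm//.
have -> : (- U)^T = - U^T by apply/matrixP => i j; rewrite !mxE.
by rewrite mulNmx mulmxN opprK.
Qed.

Lemma nuclear_norm_scale (R : realType) k s (c : R) (A : 'M[R]_(k, s)) :
  c * nuclear_norm A <= nuclear_norm (c *: A).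
Proof.
have [sg0 _ [U [V [U1 V1 AE]]]] := singular_values_spec A.
have -> : c * nuclear_norm A = \tr (U^T *m (c *: A) *m V).
  rewrite -scalemxAr -scalemxAl linearZ /=; congr (_ * _).
  rewrite /nuclear_norm; set sg := singular_values A in AE *.
  by rewrite AE !mulmxA U1 mul1mx -mulmxA V1 mulmx1 mxtrace_diag.
exact: trace_le_nuclear_norm.
Qed.

Lemma gram_trace_singular (R : realType) k s (A : 'M[R]_(k, s)) :
  \tr (A^T *m A) = \sum_i singular_values A 0 i ^+ 2 /\
  \tr (A^T *m A *m (A^T *m A)) = \sum_i singular_values A 0 i ^+ 4.
Proof.
have [sg0 _ [U [V [U1 V1 AE]]]] := singular_values_spec A.
set sg := singular_values A in sg0 AE *.
pose D := diag_mx (map_mx (fun x => x ^+ 2) sg).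
have DE : diag_mx sg *m diag_mx sg = D.
  by rewrite mulmx_diag; congr diag_mx; apply/rowP => i; rewrite !mxE expr2.
have AA : A^T *m A = V *m D *m V^T.
  rewrite AE !trmx_mul trmxK tr_diag_mx !mulmxA -(mulmxA _ U^T) U1 mulmx1.
  by rewrite -(mulmxA V (diag_mx sg) (diag_mx sg)) DE.
have trV (X : 'M[R]_(minn k s)) : \tr (V *m X *m V^T) = \tr X.
  by rewrite mxtrace_mulC mulmxA V1 mul1mx.
split; first by rewrite AA trV mxtrace_diag; apply: eq_bigr => i _; rewrite mxE.
have -> : A^T *m A *m (A^T *m A) = V *m (D *m D) *m V^T.
  by rewrite AA !mulmxA -(mulmxA _ V^T V) V1 mulmx1.
rewrite trV mulmx_diag mxtrace_diag; apply: eq_bigr => i _.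
by rewrite !mxE -exprD.
Qed.

(** This is y >= (3 y^2 - y^4) / 2, with contact at y = 1, summed over y = x / t
    for the singular values x. The bound is linear in the two traces, which
    makes it easy to average over a random A. *)
Lemma nuclear_norm_ge_moments (R : realType) k s (A : 'M[R]_(k, s)) (t : R) :
  0 < t ->
  (3 / t * \tr (A^T *m A) - t ^- 3 * \tr (A^T *m A *m (A^T *m A))) / 2
    <= nuclear_norm A.
Proof.
move=> t0; have [-> ->] := gram_trace_singular A.
have [sg0 _ _] := singular_values_spec A.
rewrite !mulr_sumr -sumrB mulr_suml; apply: ler_sum => i _.
set x := singular_values A 0 i; have x0 : 0 <= x by exact: sg0.
have -> : (3 / t * x ^+ 2 - t ^- 3 * x ^+ 4) / 2 =
    x - t^-1 ^+ 3 * (x * (x - t) ^+ 2 * (x + 2 * t)) / 2.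
  by field; rewrite gt_eqF.
rewrite gerBl divr_ge0// mulr_ge0// ?exprn_ge0 ?invr_ge0 ?(ltW t0)//.
apply: mulr_ge0; first exact: mulr_ge0 (sqr_ge0 _).
by rewrite addr_ge0// mulr_ge0// ltW.
Qed.

(** The average of x over all permutations of its coordinates is the constant
    vector of their mean, and its gauge is at most that of x. *)
Lemma gauge_ge_mean (R : realType) m (tau : 'rV[R]_m -> R) (x : 'rV[R]_m) :
  symmetric_gauge tau ->
  tau (const_mx 1) * (\sum_i x 0 i) <= m%:R * tau x.
Proof.
move=> g; case: m tau x g => [|m] tau x g.
  by rewrite big_ord0 mulr0 mul0r.
pose S := \sum_(p : 'S_m.+1) col_perm p x.
pose C := \sum_(p : 'S_m.+1) x 0 (p 0).
have tau_sum (I : finType) (F : I -> 'rV[R]_m.+1) :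
    tau (\sum_i F i) <= \sum_i tau (F i).
  elim/big_rec2 : _ => [|i a b _ ab].
    by rewrite -(scale0r 0) (gauge_homo g) normr0 mul0r.
  by apply: le_trans (gauge_triangle g _ _) _; rewrite lerD2l.
have CE j : \sum_(p : 'S_m.+1) x 0 (p j) = C.
  rewrite /C (reindex_inj (@mulgI _ (tperm 0 j))) /=.
  by apply: eq_bigr => p _; rewrite permM tpermR.
have SE : S = C *: const_mx 1.
  apply/rowP => j; rewrite !mxE mulr1 -(CE j) summxE.
  by apply: eq_bigr => p _; rewrite mxE.
have sumC : m.+1%:R * C = (\sum_i x 0 i) *+ #|{: 'S_m.+1}|.
  transitivity (\sum_(j < m.+1) \sum_(p : 'S_m.+1) x 0 (p j)).
    by under eq_bigr do rewrite CE; rewrite sumr_const card_ord mulr_natl.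
  rewrite exchange_big /= -sumr_const; apply: eq_bigr => p _.
  by rewrite [RHS](reindex_inj (@perm_inj _ p)).
have card_gt0 : 0 < #|{: 'S_m.+1}|%:R :> R.
  by rewrite ltr0n; apply/card_gt0P; exists 1%g.
have main : C * tau (const_mx 1) <= #|{: 'S_m.+1}|%:R * tau x.
  apply: (@le_trans _ _ (tau S)).
    rewrite SE (gauge_homo g) ler_wpM2r ?ler_norm//; exact: gauge_ge0.
  apply: le_trans (tau_sum _ _) _.
  under eq_bigr do rewrite (gauge_perm g).
  by rewrite sumr_const mulr_natl.
rewrite -(ler_pM2l card_gt0).
have -> : #|{: 'S_m.+1}|%:R * (tau (const_mx 1) * \sum_i x 0 i) =
   m.+1%:R * (C * tau (const_mx 1)).
  by rewrite [RHS]mulrA sumC -mulr_natl; ring.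
by rewrite [leRHS]mulrCA ler_wpM2l.
Qed.

(** Bounding each gauge by a nuclear norm first reduces the triangle inequality
    to that of the nuclear norm, at the price of a constant depending on tau
    through tau(1) only. *)
Lemma gauge_loss_pair (R : realType) k s (tau : 'rV[R]_(minn k s) -> R)
    (A B : 'M[R]_(k, s)) : symmetric_gauge tau ->
  tau (const_mx 1) * nuclear_norm (A - B) <=
  (minn k s)%:R *
    (unitarily_invariant_norm tau A + unitarily_invariant_norm tau B).
Proof.
move=> g.
apply: (@le_trans _ _ (tau (const_mx 1) * (nuclear_norm A + nuclear_norm B))).
  by rewrite ler_wpM2l ?nuclear_norm_sub//; exact: gauge_ge0.
by rewrite !mulrDr lerD//; exact: gauge_ge_mean.
Qed.

(** * Matrices with random signs *)

Definition switch (I : finType) (S : {set I}) (e : {ffun I -> bool}) :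
    {ffun I -> bool} := [ffun i => e i (+) (i \in S)].

Lemma switchK (I : finType) (S : {set I}) : involutive (switch S).
Proof. by move=> e; apply/ffunP => i; rewrite !ffunE addbK. Qed.

Lemma sum_switch (R : realType) (I : finType) (S : {set I})
    (f : {ffun I -> bool} -> R) : \sum_e f (switch S e) = \sum_e f e.
Proof. by rewrite [RHS](reindex_inj (inv_inj (switchK S))). Qed.

Definition sign_mx (R : realType) k s (S : {set 'I_k * 'I_s})
    (e : {ffun 'I_k * 'I_s -> bool}) : 'M[R]_(k, s) :=
  \matrix_(i, j) (if (i, j) \in S then (-1) ^+ e (i, j) else 0).

Lemma sign_mx_sqr (R : realType) k s (S : {set 'I_k * 'I_s}) e i j :
  sign_mx R S e i j ^+ 2 = ((i, j) \in S)%:R.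
Proof.
by rewrite mxE; case: ifP => _; rewrite ?expr0n//= -exprM mulnC exprM sqrrN
  expr1n expr1n.
Qed.

Lemma sign_mx_trace2 (R : realType) k s (S : {set 'I_k * 'I_s}) e :
  \tr ((sign_mx R S e)^T *m sign_mx R S e) = #|S|%:R.
Proof.
rewrite /mxtrace.
transitivity (\sum_j \sum_i sign_mx R S e i j ^+ 2).
  apply: eq_bigr => j _; rewrite mxE; apply: eq_bigr => i _.
  by rewrite mxE expr2.
under eq_bigr do under eq_bigr do rewrite sign_mx_sqr.
rewrite exchange_big pair_big /= -sum1_card natr_sum [RHS]big_mkcond /=.
by apply: eq_bigr => -[i j] _ /=; case: ifP.
Qed.

(** If i <> i' and j <> j', the four positions are distinct and flipping the
    sign at (i, j) negates the product, so the sum vanishes. Otherwise it is a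
    product of two squares, at most the indicator of (i, j) in S. *)
Lemma sum_sign_mx_cycle (R : realType) k s (S : {set 'I_k * 'I_s})
    (i i' : 'I_k) (j j' : 'I_s) :
  \sum_e sign_mx R S e i j * sign_mx R S e i j' *
    (sign_mx R S e i' j' * sign_mx R S e i' j) <=
  #|{ffun 'I_k * 'I_s -> bool}|%:R * ((i, j) \in S)%:R *
    ((i == i')%:R + (j == j')%:R).
Proof.
have [/eqP|] := boolP ((i != i') && (j != j')); last first.
  rewrite negb_and !negbK => ij.
  have -> : #|{ffun 'I_k * 'I_s -> bool}|%:R * ((i, j) \in S)%:R *
      ((i == i')%:R + (j == j')%:R) = \sum_(e : {ffun 'I_k * 'I_s -> bool})
      (((i, j) \in S)%:R * ((i == i')%:R + (j == j')%:R)) :> R.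
    by rewrite sumr_const -mulrA mulr_natl.
  apply: ler_sum => e _.
  have sq_le1 a b : sign_mx R S e a b ^+ 2 <= 1.
    by rewrite sign_mx_sqr lern1 leq_b1.
  case/orP: ij => /eqP <-; rewrite eqxx.
  - apply: (@le_trans _ _ ((i, j) \in S)%:R).
      rewrite -(sign_mx_sqr R S e) -[leRHS]mulr1.
      have -> : forall x y : R, x * y * (y * x) = x ^+ 2 * y ^+ 2.
        by move=> x y; ring.
      by rewrite ler_wpM2l ?sqr_ge0.
    by rewrite -[leLHS]mulr1 ler_wpM2l ?ler0n// lerDl ler0n.
  - apply: (@le_trans _ _ ((i, j) \in S)%:R).
      rewrite -(sign_mx_sqr R S e) -[leRHS]mulr1 -!expr2.
      by rewrite ler_wpM2l ?sqr_ge0.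
    by rewrite -[leLHS]mulr1 ler_wpM2l ?ler0n// lerDr ler0n.
move=> /eqP/andP[ii jj].
pose F e := sign_mx R S e i j * sign_mx R S e i j' *
  (sign_mx R S e i' j' * sign_mx R S e i' j).
have -> : \sum_e sign_mx R S e i j * sign_mx R S e i j' *
    (sign_mx R S e i' j' * sign_mx R S e i' j) = 0; last first.
  by rewrite (negbTE ii) (negbTE jj) addr0 mulr0.
have Fneg e : F (switch [set (i, j)] e) = - F e.
  have other a b : (a, b) != (i, j) ->
      sign_mx R S (switch [set (i, j)] e) a b = sign_mx R S e a b.
    by move=> ab; rewrite !mxE ffunE inE (negbTE ab) addbF.
  have same : sign_mx R S (switch [set (i, j)] e) i j = - sign_mx R S e i j.
    rewrite !mxE ffunE inE eqxx addbT; case: ifP; rewrite ?oppr0// => _.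
    by case: (e (i, j)); rewrite /= ?expr0 ?expr1 ?opprK.
  rewrite /F same !other ?mulNr// xpair_eqE.
  - by rewrite eq_sym (negbTE ii).
  - by rewrite eq_sym (negbTE ii).
  - by rewrite (eq_sym j') (negbTE jj) andbF.
rewrite -[LHS]/(\sum_e F e); have := sum_switch [set (i, j)] F.
under eq_bigr do rewrite Fneg.
by rewrite sumrN; set x := \sum_e _; lra.
Qed.

(** The trace is a sum over closed walks i, j, i', j' and only degenerate walks
    contribute: s + k of them for every (i, j) in S. *)
Lemma sum_sign_mx_trace4 (R : realType) k s (S : {set 'I_k * 'I_s}) :
  \sum_e \tr ((sign_mx R S e)^T *m sign_mx R S e *m
    ((sign_mx R S e)^T *m sign_mx R S e)) <=
  #|{ffun 'I_k * 'I_s -> bool}|%:R * (#|S|%:R * (k + s)%:R).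
Proof.
have trE e : \tr ((sign_mx R S e)^T *m sign_mx R S e *m
    ((sign_mx R S e)^T *m sign_mx R S e)) =
    \sum_j \sum_i \sum_j' \sum_i' sign_mx R S e i j * sign_mx R S e i j' *
      (sign_mx R S e i' j' * sign_mx R S e i' j).
  rewrite /mxtrace; apply: eq_bigr => j _; rewrite mxE.
  rewrite [RHS]exchange_big /=; apply: eq_bigr => j' _.
  rewrite !mxE big_distrlr /=.
  by apply: eq_bigr => i _; apply: eq_bigr => i' _; rewrite !mxE.
under eq_bigr do rewrite trE.
rewrite exchange_big /=.
under eq_bigr => j _ do rewrite exchange_big /=.
under eq_bigr => j _ do under eq_bigr => i _ do rewrite exchange_big /=.
under eq_bigr => j _ do under eq_bigr => i _ do under eq_bigr => j' _ do
  rewrite exchange_big /=.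
apply: (@le_trans _ _ (\sum_j \sum_i \sum_j' \sum_i'
  #|{ffun 'I_k * 'I_s -> bool}|%:R * ((i, j) \in S)%:R *
    ((i == i')%:R + (j == j')%:R))).
  do 4 (apply: ler_sum => ? _); exact: sum_sign_mx_cycle.
set n := #|{ffun 'I_k * 'I_s -> bool}|%:R.
have row (i : 'I_k) (j : 'I_s) : \sum_j' \sum_i'
    n * ((i, j) \in S)%:R * ((i == i')%:R + (j == j')%:R) =
    n * (((i, j) \in S)%:R * (k + s)%:R) :> R.
  under eq_bigr do rewrite -mulr_sumr big_split /=.
  rewrite -mulr_sumr big_split /= -mulrA; congr (_ * (_ * _)).
  have delta m (a : 'I_m) : \sum_b (a == b)%:R = 1 :> R.
    rewrite (bigD1 a)//= eqxx big1 ?addr0// => b.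
    by rewrite eq_sym => /negbTE ->.
  under eq_bigr do rewrite delta.
  have -> : \sum_(b : 'I_s) \sum_(c : 'I_k) (j == b)%:R = k%:R :> R.
    rewrite exchange_big /= (eq_bigr (fun=> 1)) => [|c _]; last exact: delta.
    by rewrite sumr_const card_ord.
  by rewrite sumr_const card_ord natrD addrC.
under eq_bigr do under eq_bigr do rewrite row.
rewrite exchange_big pair_big /= -mulr_sumr -mulr_suml.
rewrite ler_wpM2l ?ler0n// ler_wpM2r ?ler0n//.
rewrite -sum1_card natr_sum [leRHS]big_mkcond /=.
by apply: ler_sum => -[i j] _ /=; case: ifP.
Qed.

(** The choice t = sqrt (k \/ s) in [nuclear_norm_ge_moments] is the order of a
    typical singular value: the fourth moment then cancels only two thirds of
    the second moment term, whatever the size of S. *)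
Lemma sum_sign_mx_nuclear_norm (R : realType) k s (S : {set 'I_k * 'I_s}) :
  (0 < maxn k s)%N ->
  #|{ffun 'I_k * 'I_s -> bool}|%:R * (#|S|%:R / (2 * Num.sqrt (maxn k s)%:R)) <=
  \sum_e nuclear_norm (sign_mx R S e).
Proof.
move=> n0; set t := Num.sqrt (maxn k s)%:R.
have t0 : 0 < t by rewrite sqrtr_gt0 ltr0n.
have t2 : t ^+ 2 = (maxn k s)%:R by rewrite sqr_sqrtr// ler0n.
apply: le_trans (ler_sum _
  (fun e _ => nuclear_norm_ge_moments (sign_mx R S e) t0)).
rewrite -mulr_suml sumrB -!mulr_sumr.
under eq_bigr do rewrite sign_mx_trace2.
set F := #|{ffun _ -> _}|%:R.
have -> : \sum_(e : {ffun 'I_k * 'I_s -> bool}) #|S|%:R = F * #|S|%:R :> R.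
  by rewrite sumr_const mulr_natl.
apply: (@le_trans _ _ ((3 / t * (F * #|S|%:R) -
   t ^- 3 * (F * (#|S|%:R * (2 * t ^+ 2)))) / 2)).
  by rewrite le_eqVlt; apply/orP; left; apply/eqP; field; rewrite gt_eqF.
rewrite ler_pM2r ?invr_gt0// lerB// ler_pM2l ?invr_gt0 ?exprn_gt0//.
apply: le_trans (sum_sign_mx_trace4 _ _) _.
rewrite ler_wpM2l ?ler0n// ler_wpM2l ?ler0n// t2 -natrM ler_nat mul2n -addnn.
by rewrite leq_add ?leq_maxl ?leq_maxr.
Qed.

(** * Mixtures over sets of uninformative coordinates *)

(** Think of p e as the mass functions of one coordinate under the two values e
    of its parameter, of f as the loss, and of h S e as a lower bound on the sum
    of the losses at two parameters differing exactly on S. In the expansion of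
    the product of p = q + (p - q), the weight of the term S depends on e only
    off S; it is therefore the same for e and switch S e, and pairing them
    replaces f by h / 2. The weights are then summed over x and bounded below
    independently of e, and the sum of |S| over S is computed coordinate by
    coordinate.

    The masses of p are only assumed to be at least b, not equal to 1, because x
    ranges over a truncated observation space. *)
Lemma mixture_lower_bound (R : realType) (I X : finType) (p : bool -> X -> R)
    (q : X -> R) (b c : R) (f : {ffun I -> bool} -> {ffun I -> X} -> R)
    (h : {set I} -> {ffun I -> bool} -> R) :
  (forall x, 0 <= q x) -> (forall e x, q x <= p e x) ->
  (forall e, b <= \sum_x p e x) -> \sum_x q x <= b ->
  (forall (S : {set I}) e, 0 <= h S e) ->
  (forall (S : {set I}) e x, h S e <= f e x + f (switch S e) x) ->
  (forall S : {set I},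
     #|{ffun I -> bool}|%:R * (#|S|%:R * c) <= \sum_e h S e) ->
  #|{ffun I -> bool}|%:R *
    (c / 2 * (#|I|%:R * ((\sum_x q x) * b ^+ #|I|.-1))) <=
  \sum_(e : {ffun I -> bool}) \sum_(x : {ffun I -> X})
    (\prod_i p (e i) (x i)) * f e x.
Proof.
move=> q0 qp bp qb h0 hf hc; set Q := \sum_x q x in qb *.
have Q0 : 0 <= Q by exact: sumr_ge0.
pose r e x := p e x - q x.
have r0 e x : 0 <= r e x by rewrite subr_ge0.
pose w (S : {set I}) (e : {ffun I -> bool}) (x : {ffun I -> X}) :=
  \prod_i (if i \in S then q (x i) else r (e i) (x i)).
have w0 S e x : 0 <= w S e x by apply: prodr_ge0 => i _; case: ifP.
have pw (e : {ffun I -> bool}) (x : {ffun I -> X}) :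
    \prod_i p (e i) (x i) = \sum_(S : {set I}) w S e x.
  transitivity (\prod_i (q (x i) + r (e i) (x i))).
    by apply: eq_bigr => i _; rewrite /r addrC subrK.
  by rewrite bigA_distr; apply: eq_bigl => S; rewrite inE.
have wswitch S e x : w S (switch S e) x = w S e x.
  apply: eq_bigr => i _; case: ifP => // iS; by rewrite ffunE iS addbF.
have -> : \sum_(e : {ffun I -> bool}) \sum_(x : {ffun I -> X})
      (\prod_i p (e i) (x i)) * f e x =
    \sum_(S : {set I}) \sum_x \sum_e w S e x * f e x.
  under eq_bigr do under eq_bigr do rewrite pw mulr_suml.
  under eq_bigr do rewrite exchange_big /=.
  by rewrite exchange_big /=; apply: eq_bigr => S _; rewrite exchange_big.
have pairing S x : 2^-1 * \sum_e w S e x * h S e <= \sum_e w S e x * f e x.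
  rewrite -(@ler_pM2l _ 2)// mulrA mulfV// mul1r mulr_natl mulr2n.
  rewrite -[X in _ <= _ + X](sum_switch S) -big_split /=; apply: ler_sum => e _.
  by rewrite wswitch -mulrDr ler_wpM2l.
pose W (S : {set I}) := \prod_(i : I) (if i \in S then Q else b - Q).
have W0 S : 0 <= W S by apply: prodr_ge0 => i _; case: ifP; rewrite ?subr_ge0.
have Ww S e : W S <= \sum_x w S e x.
  rewrite /w -(bigA_distr_bigA (fun i x => if i \in S then q x else r (e i) x)).
  apply: ler_prod => i _; case: ifP => _; first by rewrite Q0 lexx.
  by rewrite subr_ge0 qb /r sumrB lerD2r bp.
apply: (@le_trans _ _ (\sum_(S : {set I}) 2^-1 * \sum_e W S * h S e));
    last first.
  apply: ler_sum => S _.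
  apply: (@le_trans _ _ (\sum_x 2^-1 * \sum_e w S e x * h S e));
    last exact: ler_sum.
  rewrite -[leRHS]mulr_sumr ler_wpM2l ?invr_ge0// exchange_big /=.
  by apply: ler_sum => e _; rewrite -mulr_suml ler_wpM2r.
apply: (@le_trans _ _ (\sum_(S : {set I})
    2^-1 * (W S * (#|{ffun I -> bool}|%:R * (#|S|%:R * c))))); last first.
  by apply: ler_sum => S _; rewrite ler_wpM2l ?invr_ge0// -mulr_sumr ler_wpM2l.
(* W is the weight of a random set containing each i with weight Q and avoiding
   it with weight b - Q, so the sets containing a given i weigh Q b^(N - 1). *)
have main : \sum_(S : {set I}) W S * #|S|%:R = #|I|%:R * (Q * b ^+ #|I|.-1).
  transitivity (\sum_(S : {set I}) \sum_(i : I) (i \in S)%:R * W S).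
    apply: eq_bigr => S _; rewrite -mulr_suml mulrC; congr (_ * _).
    rewrite -sum1_card natr_sum big_mkcond /=.
    by apply: eq_bigr => i _; case: ifP.
  rewrite exchange_big /=.
  transitivity (\sum_(i : I) Q * b ^+ #|I|.-1); last first.
    by rewrite sumr_const mulr_natl.
  apply: eq_bigr => i _.
  transitivity (\prod_(l : I) (Q + (if l == i then 0 else b - Q))).
    rewrite bigA_distr; apply: eq_big => [S|S _]; first by rewrite inE.
    rewrite /W; case: (boolP (i \in S)) => iS.
      rewrite mul1r; apply: eq_bigr => l _; case: ifP => // lS.
      by case: eqP => // li; rewrite li iS in lS.
    by rewrite mul0r (bigD1 i)//= (negbTE iS) eqxx mul0r.
  rewrite (bigD1 i)//= eqxx addr0; congr (_ * _).
  under eq_bigr => l li do rewrite (negbTE li) addrC subrK.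
  by rewrite prodr_const cardC1.
rewrite le_eqVlt; apply/orP; left; apply/eqP; rewrite -main.
rewrite !mulr_sumr; apply: eq_bigr => S _; ring.
Qed.

(** A total mass of at most 1 suffices for Jensen's inequality here, by
    2 v f - v^2 <= f^2; one e does at least as well as the average. *)
Lemma second_moment_ge_sqr_mean (R : realType) (E X : finType)
    (w f : E -> X -> R) (v : R) : (0 < #|E|)%N -> 0 <= v ->
  (forall e x, 0 <= w e x) -> (forall e, \sum_x w e x <= 1) ->
  #|E|%:R * v <= \sum_e \sum_x w e x * f e x ->
  exists e, v ^+ 2 <= \sum_x w e x * f e x ^+ 2.
Proof.
move=> E0 v0 w0 w1 mean.
have [//|none] := pselect (exists e, v ^+ 2 <= \sum_x w e x * f e x ^+ 2).
have small e : \sum_x w e x * f e x ^+ 2 < v ^+ 2.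
  by rewrite ltNge; apply/negP => ve; apply: none; exists e.
have [e0 _] := card_gt0P E0.
have : \sum_e \sum_x w e x * f e x ^+ 2 < \sum_(e : E) v ^+ 2.
  apply: ltr_sum => //; apply/hasP; exists e0 => //; exact: mem_index_enum.
have lin e : 2 * v * (\sum_x w e x * f e x) - v ^+ 2 <=
    \sum_x w e x * f e x ^+ 2.
  apply: (@le_trans _ _ (\sum_x w e x * (2 * v * f e x - v ^+ 2))).
    under [leRHS]eq_bigr do rewrite mulrBr mulrCA.
    rewrite sumrB -mulr_sumr lerD2l lerN2 -mulr_suml.
    by rewrite -[leRHS]mul1r ler_wpM2r ?sqr_ge0.
  apply: ler_sum => x _; apply: ler_wpM2l => //.
  by have := sqr_ge0 (f e x - v); rewrite sqrrB; lra.
have := ler_sum (index_enum E) (fun e (_ : true) => lin e).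
rewrite sumrB -mulr_sumr !sumr_const -mulr_natl.
have := ler_wpM2l (mulr_ge0 (ltW (@ltr0Sn R 1)) v0) mean.
rewrite expr2; lra.
Qed.

(** * Two overlapping Poisson laws *)

Lemma poisson_pmfE (R : realType) (r : R) n :
  0 < r -> poisson_pmf r n = expR (- r) * exp_coeff r n.
Proof. by move=> r0; rewrite /poisson_pmf r0 mulrC. Qed.

Lemma sum_poisson_pmf (R : realType) (r : R) K :
  0 < r -> \sum_(x < K) poisson_pmf r x = expR (- r) * series (exp_coeff r) K.
Proof.
move=> r0; rewrite /series /= big_mkord mulr_sumr.
by apply: eq_bigr => x _; rewrite poisson_pmfE.
Qed.

Lemma sum_poisson_pmf_cvg (R : realType) (r : R) :
  0 < r -> (fun K => \sum_(x < K) poisson_pmf r x) @ \oo --> (1 : R).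
Proof.
move=> r0; under eq_fun do rewrite sum_poisson_pmf//.
have -> : 1 = expR (- r) * expR r by rewrite expRN mulVf// gt_eqF// expR_gt0.
by apply: cvgMr; exact: is_cvg_series_exp_coeff.
Qed.

Lemma sum_poisson_pmf_le1 (R : realType) (r : R) K :
  0 < r -> \sum_(x < K) poisson_pmf r x <= 1.
Proof.
move=> r0; have cvg1 := sum_poisson_pmf_cvg r0.
rewrite -(cvg_lim (@Rhausdorff R) cvg1).
apply: (nondecreasing_cvgn_le _ (cvgP _ cvg1)).
apply/nondecreasing_seqP => n; rewrite big_ord_recr /= lerDl.
exact: poisson_pmf_ge0.
Qed.

Lemma bernoulli_inequality (R : realType) (x : R) n :
  0 <= x <= 1 -> 1 - n%:R * x <= (1 - x) ^+ n.
Proof.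
move=> /andP[x0 x1]; elim: n => [|n IH]; first by rewrite mul0r subr0 expr0.
rewrite exprS; apply: le_trans (ler_wpM2l _ IH); last by rewrite subr_ge0.
rewrite -natr1; have : 0 <= n%:R * x ^+ 2 by rewrite mulr_ge0 ?sqr_ge0.
by lra.
Qed.

(** Up to the factor exp ((b - a)^2 / a), the summand is the mass function of
    the Poisson law of rate b^2 / a. *)
Lemma poisson_likelihood_second_moment (R : realType) (a b : R) K :
  0 < a -> 0 < b ->
  \sum_(x < K) poisson_pmf b x ^+ 2 / poisson_pmf a x <=
    expR ((b - a) ^+ 2 / a).
Proof.
move=> a0 b0.
have c0 : 0 < b ^+ 2 / a by rewrite divr_gt0// exprn_gt0.
have termE x : poisson_pmf b x ^+ 2 / poisson_pmf a x =
    expR ((b - a) ^+ 2 / a) * poisson_pmf (b ^+ 2 / a) x.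
  rewrite !poisson_pmfE// /exp_coeff /=.
  have -> : (b - a) ^+ 2 / a = b ^+ 2 / a - b - b + a by field; rewrite gt_eqF.
  rewrite !expRD !expRN expr_div_n -exprM mulnC exprM.
  field.
  by rewrite !gt_eqF ?expR_gt0 ?exprn_gt0 ?ltr0n ?fact_gt0.
under eq_bigr do rewrite termE.
rewrite -mulr_sumr -[leRHS]mulr1 ler_wpM2l ?expR_ge0//.
exact: sum_poisson_pmf_le1.
Qed.

(** With r = q / p this is min(1, r) >= 3/4 - (r - 1)^2, where r >= 3/4 -
    (r - 1)^2 amounts to (r - 1/2)^2 >= 0. *)
Lemma min_ge_quadratic (R : realType) (p q : R) :
  0 < p -> - (p / 4) + 2 * q - q ^+ 2 / p <= Num.min p q.
Proof.
move=> p0; rewrite le_min; apply/andP; split; rewrite -subr_ge0.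
  have -> : p - (- (p / 4) + 2 * q - q ^+ 2 / p) =
      p^-1 * ((q - p) ^+ 2 + p ^+ 2 / 4) by field; rewrite gt_eqF.
  by rewrite mulr_ge0 ?invr_ge0 ?addr_ge0 ?divr_ge0 ?sqr_ge0// ltW.
have -> : q - (- (p / 4) + 2 * q - q ^+ 2 / p) = p^-1 * (q - p / 2) ^+ 2.
  by field; rewrite gt_eqF.
by rewrite mulr_ge0 ?invr_ge0 ?sqr_ge0// ltW.
Qed.

(** Summing [min_ge_quadratic] gives at least - 1/4 + 2 * 15/16 - exp (1/12),
    and exp (1/12) <= 12/11. *)
Lemma poisson_overlap (R : realType) (a b : R) K :
  0 < a -> 0 < b -> (b - a) ^+ 2 / a <= 1 / 12 ->
  15 / 16 <= \sum_(x < K) poisson_pmf b x ->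
  1 / 2 <= \sum_(x < K) Num.min (poisson_pmf a x) (poisson_pmf b x).
Proof.
move=> a0 b0 ab massb.
have pa0 x : 0 < poisson_pmf a x.
  rewrite poisson_pmfE// mulr_gt0 ?expR_gt0//.
  by rewrite divr_gt0 ?exprn_gt0 ?ltr0n ?fact_gt0.
apply: (@le_trans _ _ (\sum_(x < K) (- (poisson_pmf a x / 4) +
    2 * poisson_pmf b x - poisson_pmf b x ^+ 2 / poisson_pmf a x))); last first.
  by apply: ler_sum => x _; exact: min_ge_quadratic.
rewrite sumrB big_split /= sumrN -mulr_sumr -mulr_suml.
have massa := sum_poisson_pmf_le1 K a0.
have second : \sum_(x < K) poisson_pmf b x ^+ 2 / poisson_pmf a x <= 12 / 11.
  apply: le_trans (poisson_likelihood_second_moment K a0 b0) _.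
  apply: (@le_trans _ _ (expR (1 / 12))); first by rewrite ler_expR.
  rewrite -[1 / 12]opprK expRN -[12 / 11]invrK lef_pV2 ?posrE ?expR_gt0//.
  by apply: le_trans (expR_ge1Dx _); lra.
by lra.
Qed.

(** The same rates serve small and large l: D <= l / 4 keeps the smaller rate
    of order l, and D^2 <= l / 16 then makes the chi-square divergence small.
    The bound b on the truncated masses must be so close to 1 that its power
    over all coordinates stays above 1/2, hence the dependence of K on N. *)
Lemma two_poisson_rates (R : realType) (l : R) N : 0 < l ->
  let D := Num.min l (Num.sqrt l) / 4 in
  [/\ 0 < D, 0 < l - D & exists K : nat, exists2 b : R,
    [/\ b <= \sum_(x < K) poisson_pmf (l - D) x,
        b <= \sum_(x < K) poisson_pmf l x &
        1 / 2 <= b ^+ N] &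
    1 / 2 <= \sum_(x < K) Num.min (poisson_pmf (l - D) x) (poisson_pmf l x)
          <= b].
Proof.
move=> l0 D.
have s0 : 0 < Num.sqrt l by rewrite sqrtr_gt0.
have D0 : 0 < D by rewrite divr_gt0// lt_min l0 s0.
have Dl : D <= l / 4 by rewrite ler_pM2r ?invr_gt0// ge_min lexx.
have D2 : D ^+ 2 <= l / 16.
  have : D <= Num.sqrt l / 4 by rewrite ler_pM2r ?invr_gt0// ge_min lexx orbT.
  rewrite -(@ler_pXn2r _ 2)// ?nnegrE ?(ltW D0) ?divr_ge0 ?sqrtr_ge0//.
  rewrite [(Num.sqrt l / 4) ^+ 2]expr_div_n sqr_sqrtr ?(ltW l0)//; lra.
have a0 : 0 < l - D by lra.
split=> //.
(* Both masses will exceed 1 - eta, and N eta <= 1/16. *)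
pose eta : R := (16 * N.+1%:R)^-1.
have N1 : 0 < N.+1%:R :> R by rewrite ltr0n.
have eta0 : 0 < eta by rewrite invr_gt0 mulr_gt0.
have etaN : N.+1%:R * eta = 1 / 16 by rewrite /eta; field; rewrite gt_eqF.
have eta1 : eta <= 1 / 16.
  by rewrite -etaN ler_peMl ?(ltW eta0) ?ler1n.
have near_one r : 0 < r ->
    \forall K \near \oo, 1 - eta < \sum_(x < K) poisson_pmf r x.
  by move=> r0; apply: (cvgr_gt _ (sum_poisson_pmf_cvg r0)); lra.
have [K [Ka Kb]] := filter_ex (filterI (near_one _ a0) (near_one _ l0)).
set A := \sum_(x < K) poisson_pmf (l - D) x in Ka *.
set B := \sum_(x < K) poisson_pmf l x in Kb *.
exists K, (Num.min A B).
  split; rewrite ?ge_min ?lexx ?orbT//.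
  apply: (@le_trans _ _ ((1 - eta) ^+ N)).
    apply: le_trans (bernoulli_inequality _ _); last by apply/andP; lra.
    have : N.+1%:R * eta = N%:R * eta + eta by rewrite -natr1; ring.
    lra.
  rewrite lerXn2r ?nnegrE ?le_min ?(ltW Ka) ?(ltW Kb)//; first lra.
  by apply/andP; split; lra.
apply/andP; split.
  apply: poisson_overlap => //; last by rewrite -/B; lra.
  rewrite ler_pdivrMr//; have -> : l - (l - D) = D by ring.
  lra.
by rewrite le_min; apply/andP; split; apply: ler_sum => x _;
  rewrite ge_min lexx ?orbT.
Qed.

(** * Expectations under independent Poisson observations *)

(** Monotonicity without measurability: every simple function below f is also
    below g. *)
Lemma le_integral_nonneg d (T : measurableType d) (R : realType)
    (mu : {measure set T -> \bar R}) (f g : T -> \bar R) :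
  (forall x, (0 <= f x)%E) -> (forall x, (f x <= g x)%E) ->
  (\int[mu]_x f x <= \int[mu]_x g x)%E.
Proof.
move=> f0 fg.
rewrite !ge0_integralTE//; last by move=> x; exact: le_trans (fg x).
apply: ereal_sup_le => _ [h hf <-]; exists h => // x.
exact: le_trans (hf x) (fg x).
Qed.

Lemma poisson_prob_set1 (R : realType) (r : R) m n : 0 < r ->
  poisson_prob r m [set n] = (poisson_pmf r n)%:E.
Proof.
by move=> r0; rewrite /poisson_prob r0 esum_set1// lee_fin poisson_pmf_ge0.
Qed.

Lemma poisson_observation_prob (R : realType) d (T : measurableType d)
    (P : probability T R) k s (X : 'I_k -> 'I_s -> {mfun T >-> nat})
    (L : 'M[R]_(k, s)) (x : 'M[nat]_(k, s)) :
  (forall i j, 0 < L i j) -> independent_poisson P X L ->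
  measurable [set w | observation X w = x] /\
  P [set w | observation X w = x] =
    (\prod_(p : 'I_k * 'I_s) poisson_pmf (L p.1 p.2) (x p.1 p.2))%:E.
Proof.
move=> L0 [dist indep].
have setE : [set w | observation X w = x] =
    \bigcap_(p in [set` [set: 'I_k * 'I_s]%SET])
      (X p.1 p.2 : T -> nat) @^-1` [set x p.1 p.2].
  apply/seteqP; split => w /=.
    by move=> <- p _ /=; rewrite mxE.
  move=> Xw; apply/matrixP => i j; rewrite mxE.
  by apply: (Xw (i, j)); rewrite /= inE.
split.
  rewrite setE.
  apply: fin_bigcap_measurable => [|p _]; first exact: finite_finset.
  by rewrite -[X in measurable X]setTI; apply: measurable_funP.
rewrite setE (indep [set: 'I_k * 'I_s]%SET (fun p => [set x p.1 p.2]))//.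
under eq_bigl do rewrite inE.
rewrite -prodEFin; apply: eq_bigr => p _.
by rewrite -(poisson_prob_set1 0)// -dist.
Qed.

(** The events that the observation equals a given matrix are disjoint, so g of
    the observation dominates the sum of its values on these events. *)
Lemma expectation_ge_partial_sum (R : realType) d (T : measurableType d)
    (P : probability T R) k s (X : 'I_k -> 'I_s -> {mfun T >-> nat})
    (L : 'M[R]_(k, s)) (g : 'M[nat]_(k, s) -> R) K :
  (forall i j, 0 < L i j) -> independent_poisson P X L ->
  (forall x, 0 <= g x) ->
  ((\sum_(x : {ffun 'I_k * 'I_s -> 'I_K})
     (\prod_p poisson_pmf (L p.1 p.2) (x p)) *
       g (\matrix_(i, j) (x (i, j) : nat)))%:E
   <= 'E_P[fun w => g (observation X w)])%E.
Proof.
move=> L0 indep g0.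
pose mx (x : {ffun 'I_k * 'I_s -> 'I_K}) : 'M[nat]_(k, s) :=
  \matrix_(i, j) (x (i, j) : nat).
pose A x := [set w | observation X w = mx x].
have AP x : measurable (A x) /\ P (A x) =
    (\prod_(p : 'I_k * 'I_s) poisson_pmf (L p.1 p.2) (mx x p.1 p.2))%:E.
  exact: poisson_observation_prob.
have mx_inj : injective mx.
  move=> x y /matrixP xy; apply/ffunP => -[i j]; apply/val_inj.
  by have := xy i j; rewrite !mxE.
rewrite expectation.unlock.
apply: (@le_trans _ _ (\int[P]_w (\sum_x (g (mx x) * \1_(A x) w)%:E))%E);
    last first.
  apply: le_integral_nonneg => w.
    by apply: sume_ge0 => x _; rewrite lee_fin mulr_ge0.
  rewrite sumEFin lee_fin.
  have [[x0 Ex0]|none] := pselect (exists x, A x w).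
    rewrite (bigD1 x0)//= big1 => [|x xx0].
      rewrite addr0 Ex0 indicE ler_piMr//.
      by case: (_ \in _).
    rewrite indicE memNset ?mulr0// => Axw.
    by move/eqP: xx0; apply; apply: mx_inj; rewrite -Ex0 -Axw.
  rewrite big1// => x _; rewrite indicE memNset ?mulr0// => Axw.
  by apply: none; exists x.
rewrite ge0_integral_sum//; last 2 first.
- move=> x; apply/measurable_EFinP; apply: measurable_funM => //.
  by apply: measurable_indic; exact: (AP x).1.
- by move=> x w _; rewrite lee_fin mulr_ge0.
rewrite -sumEFin; apply: lee_sum => x _.
under eq_integral do rewrite EFinM.
rewrite ge0_integralZl//; last 2 first.
- apply/measurable_EFinP; apply: measurable_indic; exact: (AP x).1.
- by rewrite lee_fin.
rewrite integral_indic ?setIT//; last exact: (AP x).1.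
rewrite [X in (_ <= _ * X)%E](AP x).2 -EFinM lee_fin mulrC ler_wpM2l//.
rewrite le_eqVlt; apply/orP; left; apply/eqP.
by apply: eq_bigr => -[i j] _; rewrite mxE.
Qed.

(** * The minimax lower bound *)

Lemma sqr_min_sqrt (R : realType) (l : R) :
  0 < l -> Num.min l (Num.sqrt l) ^+ 2 = Num.min l (l ^+ 2).
Proof.
move=> l0; have s0 := sqrtr_ge0 l; have s2 := sqr_sqrtr (ltW l0).
have [ls|sl] := leP l (Num.sqrt l).
  by apply/esym/min_idPr; rewrite -{2}s2 ler_pXn2r ?nnegrE ?(ltW l0).
apply/esym; rewrite s2; apply/min_idPl.
by rewrite -{1}s2 ler_pXn2r ?nnegrE ?(ltW l0) ?(ltW sl).
Qed.

Definition two_rate_mx (R : realType) k s (l D : R)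
    (e : {ffun 'I_k * 'I_s -> bool}) : 'M[R]_(k, s) :=
  \matrix_(i, j) (if e (i, j) then l - D else l).

Lemma two_rate_mx_switch (R : realType) k s (l D : R) S e :
  two_rate_mx l D e - two_rate_mx l D (switch S e) =
    D *: sign_mx R S e :> 'M[R]_(k, s).
Proof.
apply/matrixP => i j; rewrite !mxE ffunE.
case: ((i, j) \in S); case: (e (i, j)); rewrite /= ?expr0 ?expr1; ring.
Qed.

Lemma gauge_loss_separation (R : realType) k s (tau : 'rV[R]_(minn k s) -> R)
    (l D : R) (A : 'M[R]_(k, s)) S e :
  (0 < minn k s)%N -> symmetric_gauge tau ->
  tau (const_mx 1) / (minn k s)%:R * nuclear_norm (D *: sign_mx R S e) <=
  unitarily_invariant_norm tau (A - two_rate_mx l D e) +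
  unitarily_invariant_norm tau (A - two_rate_mx l D (switch S e)).
Proof.
move=> m0 g; rewrite mulrAC ler_pdivrMr ?ltr0n//.
rewrite [leRHS]mulrC [X in _ <= _ * X]addrC.
rewrite -(two_rate_mx_switch l).
have -> : two_rate_mx l D e - two_rate_mx l D (switch S e) =
    (A - two_rate_mx l D (switch S e)) - (A - two_rate_mx l D e).
  by rewrite opprB [RHS]addrC addrA subrK.
exact: gauge_loss_pair.
Qed.

Lemma separation_mass (R : realType) k s (tau : 'rV[R]_(minn k s) -> R)
    (D : R) (S : {set 'I_k * 'I_s}) :
  (0 < maxn k s)%N -> symmetric_gauge tau -> 0 <= D ->
  #|{ffun 'I_k * 'I_s -> bool}|%:R * (#|S|%:R *
    (tau (const_mx 1) / (minn k s)%:R * (D / (2 * Num.sqrt (maxn k s)%:R)))) <=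
  \sum_e tau (const_mx 1) / (minn k s)%:R * nuclear_norm (D *: sign_mx R S e).
Proof.
move=> n0 g D0; set t := tau _ / _.
have t0 : 0 <= t by rewrite divr_ge0// (gauge_ge0 g).
apply: (@le_trans _ _ (\sum_e t * (D * nuclear_norm (sign_mx R S e))));
    last first.
  by apply: ler_sum => e _; rewrite ler_wpM2l// nuclear_norm_scale.
rewrite -!mulr_sumr.
have := ler_wpM2l (mulr_ge0 t0 D0) (sum_sign_mx_nuclear_norm R S n0).
rewrite -[X in _ <= X -> _]mulrA; apply: le_trans.
rewrite le_eqVlt; apply/orP; left; apply/eqP; ring.
Qed.

Theorem theorem7 (R : realType) :
  exists c : R, 0 < c /\
  forall (k s : nat) (lambda : R) (tau : 'rV[R]_(minn k s) -> R)
    (d : measure_display) (T : measurableType d)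
    (P : 'M[R]_(k, s) -> probability T R)
    (X : 'I_k -> 'I_s -> {mfun T >-> nat}),
    (0 < k)%N -> (0 < s)%N -> 0 < lambda ->
    symmetric_gauge tau ->
    (forall L : 'M[R]_(k, s), Gamma k s lambda L ->
       independent_poisson (P L) X L) ->
    ((c * (maxn k s)%:R * tau (const_mx 1) ^+ 2
        * Num.min lambda (lambda ^+ 2))%:E
     <= minimax_risk P X (unitarily_invariant_norm tau) (Gamma k s lambda))%E.
Proof.
exists (64^-1 ^+ 2); split; first by rewrite exprn_gt0// invr_gt0 ltr0n.
move=> k s l tau d T P X k0 s0 l0 g model.
have m0 : (0 < minn k s)%N by rewrite leq_min k0.
have n0 : (0 < maxn k s)%N by rewrite leq_max k0.
have [D0 lD0 [K [b [mass_lD mass_l bN] /andP[overlap overlap_b]]]] :=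
  two_poisson_rates (k * s).-1 l0.
set D := Num.min l (Num.sqrt l) / 4 in D0 lD0 mass_lD overlap overlap_b.
apply: le_ereal_inf_tmp => _ [est _ <-].
pose p (e : bool) (x : 'I_K) := poisson_pmf (if e then l - D else l) x.
have rate0 (e : bool) : 0 < (if e then l - D else l) by case: e.
pose w (e : {ffun 'I_k * 'I_s -> bool}) (x : {ffun 'I_k * 'I_s -> 'I_K}) :=
  \prod_i p (e i) (x i).
pose f (e : {ffun 'I_k * 'I_s -> bool}) (x : {ffun 'I_k * 'I_s -> 'I_K}) :=
  unitarily_invariant_norm tau
    (est (\matrix_(i, j) (x (i, j) : nat)) - two_rate_mx l D e).
pose c := tau (const_mx 1) / (minn k s)%:R * (D / (2 * Num.sqrt (maxn k s)%:R)).
have c0 : 0 <= c.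
  apply: mulr_ge0; first by rewrite divr_ge0//; exact: (gauge_ge0 g).
  by apply: divr_ge0; [exact: ltW|exact: mulr_ge0 (sqrtr_ge0 _)].
pose v := c / 8 * (k * s)%:R.
have v0 : 0 <= v by rewrite mulr_ge0// divr_ge0.
have w0 e x : 0 <= w e x by apply: prodr_ge0 => i _; exact: poisson_pmf_ge0.
have w1 e : \sum_x w e x <= 1.
  rewrite /w -(bigA_distr_bigA (fun i => p (e i))) /=.
  apply: (@le_trans _ _ (\prod_(i : 'I_k * 'I_s) 1)); last by rewrite big1.
  apply: ler_prod => i _; rewrite sum_poisson_pmf_le1// andbT.
  by apply: sumr_ge0 => x _; exact: poisson_pmf_ge0.
have mean : #|{ffun 'I_k * 'I_s -> bool}|%:R * v <= \sum_e \sum_x w e x * f e x.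
  apply: le_trans (mixture_lower_bound (p := p) (b := b) (c := c)
    (q := fun x => Num.min (poisson_pmf (l - D) x) (poisson_pmf l x))
    (h := fun S e => tau (const_mx 1) / (minn k s)%:R *
                       nuclear_norm (D *: sign_mx R S e)) _ _ _ _ _ _ _).
  - rewrite ler_wpM2l// card_prod !card_ord /v.
    have -> : c / 8 * (k * s)%:R = c / 2 * ((k * s)%:R * (1 / 2 * (1 / 2))).
      by field.
    by rewrite ler_wpM2l ?divr_ge0// ler_wpM2l// ler_pM// divr_ge0.
  - by move=> x; rewrite le_min !poisson_pmf_ge0.
  - by case=> x; rewrite /p ge_min lexx ?orbT.
  - by case.
  - exact: overlap_b.
  - move=> S e; rewrite mulr_ge0 ?nuclear_norm_ge0// divr_ge0//.
    exact: (gauge_ge0 g).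
  - by move=> S e x; exact: gauge_loss_separation.
  - by move=> S; apply: separation_mass => //; exact: ltW.
have [|e ve] := second_moment_ge_sqr_mean _ v0 w0 w1 mean.
  by apply/card_gt0P; exists [ffun=> true].
have Gamma_e : Gamma k s l (two_rate_mx l D e).
  move=> i j; rewrite mxE; case: ifP => _;
    by rewrite ?lexx ?(ltW l0) ?(ltW lD0) ?gerBl ?(ltW D0).
apply: le_ereal_sup_tmp; eexists.
  by exists (two_rate_mx l D e); [exact: Gamma_e|].
have L0 i j : 0 < two_rate_mx l D e i j by rewrite mxE.
have g0 (x : 'M[nat]_(k, s)) :
    0 <= unitarily_invariant_norm tau (est x - two_rate_mx l D e) ^+ 2 :> R.
  exact: sqr_ge0.
apply: le_trans (expectation_ge_partial_sum K L0 (model _ Gamma_e) g0).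
rewrite lee_fin.
(* v = D tau(1) sqrt (maxn k s) / 16, and D contributes the other factor 1/4
   of 1/64. *)
have -> : 64^-1 ^+ 2 * (maxn k s)%:R * tau (const_mx 1) ^+ 2 *
    Num.min l (l ^+ 2) = v ^+ 2.
  rewrite -sqr_min_sqrt// /v /c /D.
  have -> : (k * s)%:R = (minn k s)%:R * Num.sqrt (maxn k s)%:R ^+ 2 :> R.
    rewrite sqr_sqrtr// -natrM; congr _%:R.
    by rewrite /minn /maxn; case: ltnP => // _; rewrite mulnC.
  have nE : (maxn k s)%:R = Num.sqrt (maxn k s)%:R ^+ 2 :> R.
    by rewrite sqr_sqrtr.
  rewrite {1}nE; field.
  by rewrite !gt_eqF ?sqrtr_gt0 ?ltr0n.
apply: le_trans ve _; rewrite le_eqVlt; apply/orP; left; apply/eqP.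
apply: eq_bigr => x _; congr (_ * _).
by apply: eq_bigr => -[i j] _; rewrite /p mxE.
Qed.
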